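(* Let $n\in\mathbb N$ and let $A,B,F,G$ be real $n\times n$ matrices such that $F-G$ and $F+G$ are invertible. Let $E=(F-G)^{-1}(A-B)(F+G)^{-1}(A+B)$. Then $$X(t):=\sum_{k=0}^\infty\frac{E^kt^{2k}}{(2k)!}-(F+G)^{-1}(A+B)\sum_{k=0}^\infty\frac{E^kt^{2k+1}}{(2k+1)!},\qquad t\in\mathbb R,$$ is a fundamental matrix of the problem $$Fu'(t)+Gu'(-t)+Au(t)+Bu(-t)=0,\quad t\in\mathbb R.$$ If, moreover, $A-B$ and $A+B$ are invertible, then $E$ is invertible and, with $\Omega$ the square root of $E$ described in the context, $$X(t)=\cosh(\Omega t)-(F+G)^{-1}(A+B)\,\Omega^{-1}\sinh(\Omega t).$$
   Context: A fundamental matrix of the problem $Fu'(t)+Gu'(-t)+Au(t)+Bu(-t)=0$, $t\in\mathbb R$ (with $u:\mathbb R\to\mathbb R^n$) is a continuous function $X:\mathbb R\to M_n(\mathbb R)$ such that: (H1) $X$ is differentiable; (H2) $FX'(t)+GX'(-t)+AX(t)+BX(-t)=0$ for all $t\in\mathbb R$; (H3) $X(0)$ is invertible; (H4) the columns of $X$ form a basis of the space of solutions of the problem. Here $X'(-t)$ denotes the derivative $X'$ evaluated at $-t$. Square root: for an invertible complex matrix $M$ whose minimal polynomial has distinct roots $\lambda_1,\dots,\lambda_j$ with multiplicities $\mu_1,\dots,\mu_j$, the square root of $M$ used is $p(M)$ where $p\in\mathbb C[x]$ is a polynomial with $p^{(r)}(\lambda_k)=h^{(r)}(\lambda_k)$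 for $0\le r\le\mu_k-1$ and all $k$, $h$ being the principal branch of the square root, with $h^{(r)}(\lambda)=\tfrac12(\tfrac12-1)\cdots(\tfrac12-r+1)\lambda^{-r}\sqrt\lambda$ at every $\lambda\ne0$. It satisfies $p(M)^2=M$ and commutes with every matrix that commutes with $M$. $\Omega$ is this square root of $E$ (possibly with complex entries). $\cosh$ and $\sinh$ of matrices are given by their power series. *)

(* Defs.v *)
From HB Require Import structures.
From mathcomp Require Import all_boot all_order all_algebra.
From mathcomp Require Import all_classical all_reals all_analysis.
From mathcomp.real_closed Require Import complex.

Set Implicit Arguments.
Unset Strict Implicit.
Unset Printing Implicit Defensive.

Import Order.TTheory GRing.Theory Num.Theory.
Import numFieldNormedType.Exports.

Local Open Scope classical_set_scope.
Local Open Scope ring_scope.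

Definition is_basis_of (K : fieldType) (V : lmodType K) (I : finType)
    (S : set V) (b : I -> V) : Prop :=
  [/\ forall i, S (b i),
      forall c : I -> K, \sum_i c i *: b i = 0 -> forall i, c i = 0
    & forall v, S v -> exists c : I -> K, v = \sum_i c i *: b i].

(* The equation is stated for functions with values in n x m matrices, so that
   it covers both vector unknowns (m = 1) and fundamental matrices (m = n). *)
Definition reflection_eq (R : realType) (n m : nat) (F G A B : 'M[R]_n)
    (u : R -> 'M[R]_(n, m)) : Prop :=
  forall t : R,
    F *m derive1 u t + G *m derive1 u (- t) + A *m u t + B *m u (- t) = 0.

Definition solutions (R : realType) (n : nat) (F G A B : 'M[R]_n) :
    set (R -> 'cV[R]_n) :=
  [set u | (forall t : R, derivable u t 1) /\ reflection_eq F G A B u].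

Record fundamental_matrix (R : realType) (n : nat) (F G A B : 'M[R]_n)
    (X : R -> 'M[R]_n) : Prop := FundamentalMatrix {
  fm_continuous : continuous X;
  fm_derivable : forall t : R, derivable X t 1;
  fm_eq : reflection_eq F G A B X;
  fm_unit : X 0 \in unitmx;
  fm_basis : is_basis_of (solutions F G A B)
               (fun (j : 'I_n) (t : R) => col j (X t))
}.

Definition even_series (R : realType) (n : nat) (E : 'M[R]_n) (t : R) :
    nat -> 'M[R]_n :=
  [series (t ^+ (2 * k) / (2 * k)`!%:R) *: E ^+ k]_k.

Definition odd_series (R : realType) (n : nat) (E : 'M[R]_n) (t : R) :
    nat -> 'M[R]_n :=
  [series (t ^+ (2 * k).+1 / ((2 * k).+1)`!%:R) *: E ^+ k]_k.

Definition mxcosh (K : numFieldType) (n : nat) (M : 'M[K]_n) : 'M[K]_n :=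
  limn [series ((2 * k)`!%:R)^-1 *: M ^+ (2 * k)]_k.

Definition mxsinh (K : numFieldType) (n : nat) (M : 'M[K]_n) : 'M[K]_n :=
  limn [series (((2 * k).+1)`!%:R)^-1 *: M ^+ (2 * k).+1]_k.

Definition complex_mx (R : rcfType) (m n : nat) (M : 'M[R]_(m, n)) :
    'M[R[i]]_(m, n) :=
  map_mx (real_complex R) M.

(* The r-th derivative of the principal square root at l != 0. Here
   [complex.sqrtc] is the principal branch: its real part is nonnegative, and
   sqrtc (- x) = 'i * sqrt x for x > 0. The root [sqrtC] of an arbitrary
   [numClosedFieldType] has a nonnegative imaginary part instead, so it differs
   from the principal branch on the open lower half-plane. *)
Definition sqrt_deriv (R : rcfType) (r : nat) (l : R[i]) : R[i] :=
  (\prod_(i < r) (2^-1 - i%:R)) * l ^- r * complex.sqrtc l.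

Definition sqrt_interpolant (R : rcfType) (n : nat) (M : 'M[R[i]]_n.+1)
    (p : {poly R[i]}) : Prop :=
  forall l : R[i], root (mxminpoly M) l ->
  forall r : nat, (r < mup l (mxminpoly M))%N ->
    (derivn r p).[l] = sqrt_deriv r l.

Definition is_principal_sqrtmx (R : rcfType) (n : nat)
    (M N : 'M[R[i]]_n.+1) : Prop :=
  exists2 p : {poly R[i]}, sqrt_interpolant M p & N = horner_mx M p.

(* Main.v *)
Require Import Defs.
From HB Require Import structures.
From mathcomp Require Import all_boot all_order all_algebra.
From mathcomp Require Import all_classical all_reals all_analysis.
From mathcomp Require Import ring lra.
From mathcomp.real_closed Require Import complex.

Set Implicit Arguments.
Unset Strict Implicit.
Unset Printing Implicit Defensive.

Import Order.TTheory GRing.Theory Num.Theory.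
Import numFieldNormedType.Exports.

Local Open Scope classical_set_scope.
Local Open Scope ring_scope.

(* Splitting a solution into its even part [e] and odd part [o] turns the
   equation into [e' = - P o], [o' = - K e] with [P = (F - G)^-1 (A - B)] and
   [K = (F + G)^-1 (A + B)], so that [e'' = E e] with [E = P K]. The two series
   [C] and [S] satisfy [C' = E S] and [S' = C]; [C] and [S / t] are power series in [t ^ 2]
   that are differentiated entrywise. The identification with [cosh] and [sinh]
   only uses that the principal square root squares to [E]. *)

(** * Hermite interpolation and the principal square root *)

(** For the converse: if [l] is a root of [q != 0] of multiplicity [k.+1] with cofactor [s], the
    derivative has multiplicity exactly [k], since [k.+1] times [s] is nonzero at [l] in
    characteristic zero. *)
Lemma dvdp_XsubC_expS (K : numFieldType) (l : K) (m : nat) (q : {poly K}) :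
  (('X - l%:P) ^+ m.+1 %| q) = root q l && (('X - l%:P) ^+ m %| q^`()).
Proof.
apply/idP/andP => [/dvdpP[s ->]|[]].
  rewrite derivM deriv_exp derivXsubC mul1r /= rootM root_exp_XsubC eqxx orbT.
  by split=> //; rewrite mulrnAr -mulrnAl exprS mulrA -mulrDl dvdp_mull.
have [->|q0] := eqVneq q 0; first by rewrite dvdp0.
have [[|k] [s]] := multiplicity_XsubC q l; rewrite q0 /= => sl ->.
  by rewrite expr0 mulr1 (negPf sl).
rewrite derivM deriv_exp derivXsubC mul1r /= => _ qm.
have [le_mk|lt_km] := leqP m k; first by rewrite dvdp_mull ?dvdp_exp2l.
move: (dvdp_trans (dvdp_exp2l ('X - l%:P) lt_km) qm); apply: contraTT => _.
rewrite mulrnAr -mulrnAl [_ ^+ k.+1]exprS mulrA -mulrDl.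
rewrite dvdp_mul2r ?expf_neq0 ?polyXsubC_eq0// dvdp_addr ?dvdp_mull//.
by rewrite dvdp_XsubCl rootE hornerMn mulrn_eq0 -rootE (negPf sl).
Qed.

Lemma dvdp_XsubC_expP (K : numFieldType) (l : K) (m : nat) (q : {poly K}) :
  reflect (forall r, (r < m)%N -> (q^`(r)).[l] = 0) (('X - l%:P) ^+ m %| q).
Proof.
elim: m q => [|m IH] q; first by rewrite expr0 dvd1p; left.
rewrite dvdp_XsubC_expS; apply: (iffP andP) => [[/rootP q0 /IH dq] [|r] //|h].
  by rewrite ltnS => /dq; rewrite -derivSn.
split; first exact/rootP/(h 0%N).
by apply/IH => r rm; rewrite -derivSn; apply: h.
Qed.

(* Newton's scheme: prescribe one more derivative at a time, correcting by a
   multiple of a polynomial on which all the earlier conditions vanish. *)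
Lemma hermite_interpolation (K : numFieldType) (s : seq K) (mu : K -> nat)
    (d : nat -> K -> K) : uniq s ->
  exists p : {poly K}, forall l, l \in s ->
    forall r, (r < mu l)%N -> (p^`(r)).[l] = d r l.
Proof.
elim: s => [|a s IH] /=; first by exists 0.
move=> /andP[as_ /IH[p0 p0P]] {IH}.
suff [p pa ps] : exists2 p : {poly K},
    forall r, (r < mu a)%N -> (p^`(r)).[a] = d r a
  & forall l, l \in s -> forall r, (r < mu l)%N -> (p^`(r)).[l] = d r l.
  by exists p => l; rewrite inE => /predU1P[->|/ps].
elim: (mu a) => [|m [p pa ps]]; first by exists p0.
(* [W] vanishes to order [mu l] at each earlier node [l] but not at [a], so [V] has order exactly
   [m] at [a]. Adding a multiple of [V] thus changes only the [m]-th derivative at [a] among the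
   prescribed values. *)
pose W := \prod_(l <- s) ('X - l%:P) ^+ mu l.
pose V := W * ('X - a%:P) ^+ m.
have W_a : ~~ root W a.
  rewrite /W; elim: s as_ {p0 p0P pa ps W V} => [_|b s IH].
    by rewrite big_nil root1.
  rewrite inE negb_or => /andP[ab as_]; rewrite big_cons rootM negb_or IH//.
  by rewrite andbT rootE horner_exp hornerXsubC expf_neq0// subr_eq0.
have V_a r : (r < m)%N -> (V^`(r)).[a] = 0.
  by move: r; apply/dvdp_XsubC_expP; rewrite dvdp_mull.
have V_s l : l \in s -> forall r, (r < mu l)%N -> (V^`(r)).[l] = 0.
  move=> ls; apply/dvdp_XsubC_expP; rewrite dvdp_mulr// /W.
  by rewrite (perm_big _ (perm_to_rem ls)) big_cons dvdp_mulr.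
(* This value is the divisor in the correction. Were it zero, [V] would contain [m.+1] factors
   ['X - a%:P], one of them dividing [W]. *)
have V_m : (V^`(m)).[a] != 0.
  apply: contra W_a => /eqP V0.
  have : ('X - a%:P) ^+ m.+1 %| V.
    apply/dvdp_XsubC_expP => r; rewrite ltnS leq_eqVlt.
    by case/predU1P => [->|/V_a].
  by rewrite exprS dvdp_mul2r ?expf_neq0 ?polyXsubC_eq0// dvdp_XsubCl.
exists (p + ((d m a - (p^`(m)).[a]) / (V^`(m)).[a]) *: V).
  move=> r; rewrite derivnD derivnZ hornerD hornerZ ltnS leq_eqVlt.
  case/predU1P => [->|rm]; first by rewrite divfK// addrC subrK.
  by rewrite (V_a r rm) mulr0 addr0 pa.
move=> l ls r rl; rewrite derivnD derivnZ hornerD hornerZ (V_s l ls r rl).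
by rewrite mulr0 addr0 ps.
Qed.

(** [p] splits into linear factors. They are cancelled from [p] and [q] one at a time, which lowers
    both multiplicities equally and so preserves their comparison. *)
Lemma dvdp_mup (K : closedFieldType) (p q : {poly K}) : p != 0 ->
  (forall l, root p l -> ('X - l%:P) ^+ mup l p %| q) -> p %| q.
Proof.
move=> p0 pq; have [->|q0] := eqVneq q 0; first by rewrite dvdp0.
have [rs def_p] := closed_field_poly_normal p.
have lc0 : lead_coef p != 0 by rewrite lead_coef_eq0.
have mup_p l : mup l p = count_mem l rs.
  by rewrite def_p -mul_polyC mupMr ?mu_prod_XsubC// rootC.
have {}pq l : (count_mem l rs <= mup l q)%N.
  rewrite -mup_p; have [pl|/mupNroot->//] := boolP (root p l).
  by rewrite mup_geq// pq.
rewrite def_p dvdpZl// {p p0 def_p lc0 mup_p}.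
elim: rs q q0 pq => [|a rs IH] q q0 pq; first by rewrite big_nil dvd1p.
have : 'X - a%:P %| q by rewrite XsubC_dvd// (leq_trans _ (pq a))//= eqxx.
case/dvdpP=> q' def_q; move: q0; rewrite {}def_q in pq *.
rewrite mulf_eq0 negb_or polyXsubC_eq0 andbT => q'0.
rewrite big_cons mulrC dvdp_mul2r ?polyXsubC_eq0// IH// => l.
have := pq l; rewrite mupM ?polyXsubC_eq0// (@mup_XsubCX _ 1) /= addnC.
by case: eqP => _; rewrite leq_add2r.
Qed.

(** This is the differential equation [2 x h' = h] of the square root, differentiated [r] times and
    evaluated at [l]. *)
Lemma sqrt_derivS (R : rcfType) (r : nat) (l : R[i]) :
  l != 0 -> sqrt_deriv r l = 2 * (l * sqrt_deriv r.+1 l + r%:R * sqrt_deriv r l).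
Proof.
move=> l0; rewrite /sqrt_deriv big_ord_recr /= exprS invfM.
move: (\prod_(i < r) _) (l ^- r) (sqrtc l) => P Q S.
by field.
Qed.

(* With [h] the square root, [2 x h' = h]: hence [2 X p' - p] is highly
   divisible by [X - l], and so is [X q' - q = p (2 X p' - p)] where
   [q = p ^ 2 - X]. The derivatives of [q] at [l] then vanish one by one. *)
Lemma sqrt_interpolant_sqr (R : rcfType) (p : {poly R[i]}) (l : R[i]) m :
  l != 0 -> (forall r, (r < m)%N -> (p^`(r)).[l] = sqrt_deriv r l) ->
  ('X - l%:P) ^+ m %| p ^+ 2 - 'X.
Proof.
move=> l0 pl.
have derivnX (f : {poly R[i]}) r :
    ((f * 'X)^`(r)).[l] = (f^`(r)).[l] * l + (f^`(r.-1)).[l] *+ r.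
  case: r => [|r]; first by rewrite !derivn0 hornerMX mulr0n addr0.
  rewrite -[f * 'X]addr0 -polyC0 derivnMXaddC hornerD hornerMX hornerMn.
  by rewrite addrC.
set q := p ^+ 2 - 'X; pose g := 2 *: (p^`() * 'X) - p.
(* One order is lost because the [r]-th derivative of [g] involves the [r.+1]-st derivative of
   [p]. *)
have g_l : ('X - l%:P) ^+ m.-1 %| g.
  apply/dvdp_XsubC_expP => r rm; have r1m : (r.+1 < m)%N by case: m rm {pl}.
  rewrite derivnB derivnZ hornerD hornerN hornerZ derivnX -derivSn pl//.
  rewrite (pl r) ?(ltnW r1m)// (sqrt_derivS r l0).
  case: r rm r1m => [|r] rm r1m.
    by rewrite mulr0n mul0r (mulrC l) subrr.
  by rewrite /= -derivSn pl 1?ltnW// -(mulr_natl _ r.+1) (mulrC l) subrr.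
have q_g : q^`() * 'X - q = p * g.
  rewrite /q /g derivB derivX deriv_exp /= mulr2n scaler_nat.
  by rewrite expr1 expr2 !mulr2n; ring.
have : ('X - l%:P) ^+ m.-1 %| q^`() * 'X - q by rewrite q_g dvdp_mull.
move/dvdp_XsubC_expP => q_l; apply/dvdp_XsubC_expP.
elim=> [|r IH] rm.
  have := pl 0%N rm; rewrite /sqrt_deriv big_ord0 expr0 invr1 !mul1r => pl0.
  by rewrite derivn0 /q hornerD hornerN hornerX horner_exp pl0 sqr_sqrtc subrr.
have rm1 : (r < m.-1)%N by case: m rm {pl g_l q_l IH}.
have := q_l r rm1; rewrite derivnB hornerD hornerN derivnX -derivSn.
rewrite (IH (ltnW rm)) subr0.
(* At [r = 0] the predecessor is a mere default and the factor [r] kills the term; otherwise this is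
   [r] times the [r]-th derivative of [q], zero by induction. *)
have -> : ((q^`())^`(r.-1)).[l] *+ r = 0.
  by case: r {rm1} rm IH => // r rm IH; rewrite -derivSn IH ?mul0rn 1?ltnW.
by rewrite addr0 => /eqP; rewrite mulf_eq0 (negPf l0) orbF => /eqP.
Qed.

Lemma root_mxminpoly_neq0 (K : fieldType) (n : nat) (M : 'M[K]_n.+1) (l : K) :
  M \in unitmx -> root (mxminpoly M) l -> l != 0.
Proof.
move=> Mu; apply: contraTneq => ->; rewrite -eigenvalue_root_min.
apply/eigenvalueP => -[v]; rewrite scale0r => vM /negP[].
by rewrite -(mulmxK Mu v) vM mul0mx.
Qed.

Lemma principal_sqrtmx_exists (R : rcfType) (n : nat) (M : 'M[R[i]]_n.+1) :
  exists N, is_principal_sqrtmx M N.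
Proof.
have [rs def_p] := closed_field_poly_normal (mxminpoly M).
have [p pP] := hermite_interpolation (fun l => mup l (mxminpoly M))
  (@sqrt_deriv R) (undup_uniq rs).
exists (horner_mx M p), p => // l; rewrite {1}def_p => pl; apply: pP.
move: pl; rewrite rootZ ?root_prod_XsubC ?mem_undup// lead_coef_eq0.
by rewrite monic_neq0// mxminpoly_monic.
Qed.

(** Invertibility keeps the roots of the minimal polynomial away from 0, so it divides
    [p ^+ 2 - 'X], which therefore annihilates [M]. *)
Lemma principal_sqrtmx_sqr (R : rcfType) (n : nat) (M N : 'M[R[i]]_n.+1) :
  M \in unitmx -> is_principal_sqrtmx M N -> N ^+ 2 = M.
Proof.
move=> Mu [p pP ->]; rewrite -rmorphXn /=; apply/eqP; rewrite -subr_eq0.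
rewrite -[X in _ - X]horner_mx_X -rmorphB -dvd_mxminpoly.
apply: dvdp_mup => [|l pl].
  by rewrite monic_neq0// mxminpoly_monic.
apply: sqrt_interpolant_sqr => [|r rl]; last exact: pP.
exact: root_mxminpoly_neq0 pl.
Qed.

(** * Limits and derivatives of matrix-valued functions *)

Lemma cvg_mxP (K : numFieldType) (m n : nat) (T : Type) (F : set_system T)
    {FF : Filter F} (f : T -> 'M[K]_(m, n)) (M : 'M[K]_(m, n)) :
  f @ F --> M <-> forall i j, (fun x => f x i j) @ F --> M i j.
Proof.
split=> [/cvg_mx_entourageP fM i j|fM].
  apply/cvg_app_entourageP => A /fM; rewrite !near_simpl.
  by apply: filterS => x /(_ i j) /set_mem.
apply/cvg_mx_entourageP => A entA; apply: filter_forall => i.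
apply: filter_forall => j; have /cvg_app_entourageP/(_ A entA) := fM i j.
by apply: filterS => x ?; apply/mem_set.
Qed.

Lemma cvg_mulmxl (K : numFieldType) (m n p : nat) (T : Type) (F : set_system T)
    {FF : Filter F} (A : 'M[K]_(m, n)) (f : T -> 'M[K]_(n, p)) (M : 'M[K]_(n, p)) :
  f @ F --> M -> (fun x => A *m f x) @ F --> A *m M.
Proof.
move=> /cvg_mxP fM; apply/cvg_mxP => i j; rewrite mxE.
under eq_cvg do rewrite mxE.
apply: cvg_big => [|k _]; first exact: add_continuous.
by apply: cvgM; [exact: cvg_cst|exact: fM].
Qed.

Lemma cvg_mulmxr (K : numFieldType) (m n p : nat) (T : Type) (F : set_system T)
    {FF : Filter F} (f : T -> 'M[K]_(m, n)) (A : 'M[K]_(n, p)) (M : 'M[K]_(m, n)) :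
  f @ F --> M -> (fun x => f x *m A) @ F --> M *m A.
Proof.
move=> /cvg_mxP fM; apply/cvg_mxP => i j; rewrite mxE.
under eq_cvg do rewrite mxE.
apply: cvg_big => [|k _]; first exact: add_continuous.
by apply: cvgM; [exact: fM|exact: cvg_cst].
Qed.

Lemma is_derive_mxP (R : realFieldType) (m n : nat) (M : R -> 'M[R]_(m, n))
    (t : R) (D : 'M[R]_(m, n)) :
  is_derive t 1 M D <-> forall i j, is_derive t 1 (fun s => M s i j) (D i j).
Proof.
split=> [[dM <-] i j|dM].
  rewrite derive_mx// mxE; apply/derivableP.
  exact: (derivable_mxP _ _ _).1 dM i j.
have dM' : derivable M t 1 by apply/derivable_mxP => i j; have [] := dM i j.
apply: DeriveDef => //; rewrite derive_mx//.
by apply/matrixP => i j; rewrite mxE; have [_ ->] := dM i j.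
Qed.

Lemma is_derive_mulmx (R : realFieldType) (m n p : nat) (M : R -> 'M[R]_(m, n))
    (N : R -> 'M[R]_(n, p)) (t : R) (dM : 'M[R]_(m, n)) (dN : 'M[R]_(n, p)) :
  is_derive t 1 M dM -> is_derive t 1 N dN ->
  is_derive t 1 (fun s => M s *m N s) (dM *m N t + M t *m dN).
Proof.
move=> /is_derive_mxP hM /is_derive_mxP hN; apply/is_derive_mxP => i j.
have h := is_derive_sum (fun k => is_deriveM (hM i k) (hN k j)).
rewrite (_ : (fun s => _) =
    \sum_(k < n) (fun s => M s i k) * (fun s => N s k j)); last first.
  by apply/funext => s; rewrite mxE fct_sumE.
apply: (is_derive_eq h); rewrite !mxE -big_split; apply: eq_bigr => k _ /=.
by rewrite addrC; congr (_ + _); apply: mulrC.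
Qed.

Lemma is_derive_mulmxl (R : realFieldType) (m n p : nat) (A : 'M[R]_(m, n))
    (N : R -> 'M[R]_(n, p)) (t : R) (dN : 'M[R]_(n, p)) :
  is_derive t 1 N dN -> is_derive t 1 (fun s => A *m N s) (A *m dN).
Proof.
move=> hN; have := is_derive_mulmx (is_derive_cst A t 1) hN.
by rewrite mul0mx add0r.
Qed.

Lemma is_derive_mx_comp (R : realType) (m n : nat) (M : R -> 'M[R]_(m, n))
    (g : R -> R) (t dg : R) (dM : 'M[R]_(m, n)) :
  is_derive (g t) 1 M dM -> is_derive t 1 g dg ->
  is_derive t 1 (fun s => M (g s)) (dg *: dM).
Proof.
move=> /is_derive_mxP hM hg; apply/is_derive_mxP => i j; rewrite mxE mulrC.
exact: (is_derive1_comp (hM i j) hg).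
Qed.

Lemma is_derive_mx_0_is_cst (R : realType) (m n : nat) (M : R -> 'M[R]_(m, n))
    (s t : R) : (forall x : R, is_derive x (1 : R) M 0) -> M s = M t.
Proof.
move=> dM; apply/matrixP => i j.
apply: (@is_derive_0_is_cst _ (fun x => M x i j)) => x.
by have /is_derive_mxP/(_ i j) := dM x; rewrite mxE.
Qed.

(* Coefficients dominated by those of an exponential series; this class is
   stable under [pseries_diffs]. *)
Definition exp_dominated (R : realType) (c : nat -> R) : Prop :=
  exists M N : R, forall k, `|c k| <= M * (N ^+ k / k`!%:R).

(** The factor [k.+1] produced by differentiation cancels against the factorial of [k.+1]; the spare
    factor [N] joins the constant [M]. *)
Lemma exp_dominated_diffs (R : realType) (c : nat -> R) :
  exp_dominated c -> exp_dominated (pseries_diffs c).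
Proof.
move=> [M [N cMN]]; exists (M * N), N => k.
rewrite /pseries_diffs normrM ger0_norm//.
rewrite (le_trans (ler_wpM2l _ (cMN _)))// factS natrM exprS invfM.
rewrite le_eqVlt; apply/orP; left; apply/eqP; field.
by rewrite pnatr_eq0 -lt0n fact_gt0 /= addrC natr1 pnatr_eq0.
Qed.

Lemma is_cvg_exp_dominated (R : realType) (c : nat -> R) (x : R) :
  exp_dominated c -> cvgn (pseries c x).
Proof.
move=> [M [N cMN]]; apply: normed_cvg.
have M0 : 0 <= M.
  by have := cMN 0%N; rewrite expr0 fact0 invr1 !mulr1; apply: le_trans.
apply: (@series_le_cvg _ (fun k => `|c k * x ^+ k|)
  (fun k => M *: exp_coeff (`|N| * `|x|) k)) => [k|k|k|].
- exact: normr_ge0.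
- by rewrite mulr_ge0// divr_ge0// exprn_ge0// mulr_ge0.
- rewrite normrM normrX /exp_coeff /= exprMn.
  (* The sign of [N] is arbitrary, hence the comparison with the exponential series of its absolute
     value. *)
  have /(le_trans (cMN k)) : M * (N ^+ k / k`!%:R) <= M * (`|N| ^+ k / k`!%:R).
    by rewrite ler_wpM2l// ler_wpM2r// -normrX ler_norm.
  move=> /(ler_wpM2r (exprn_ge0 k (normr_ge0 x)))/le_trans; apply.
  by rewrite le_eqVlt; apply/orP; left; apply/eqP; rewrite /GRing.scale /=; ring.
- exact/is_cvg_seriesZ/is_cvg_series_exp_coeff.
Qed.

Lemma is_derive_exp_dominated (R : realType) (c : nat -> R) (x : R) :
  exp_dominated c ->
  is_derive x 1 (fun y => limn (pseries c y)) (limn (pseries (pseries_diffs c) x)).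
Proof.
(* Convergence holds everywhere, so any radius larger than the absolute value of [x] will do. *)
move=> cP; apply: (@pseries_snd_diffs _ _ (`|x| + 1)).
- exact: is_cvg_exp_dominated.
- exact/is_cvg_exp_dominated/exp_dominated_diffs.
- exact/is_cvg_exp_dominated/exp_dominated_diffs/exp_dominated_diffs.
- by rewrite [ltRHS]ger0_norm// ltrDl.
Qed.

(** * The even and odd series *)

(** The base bounds the absolute sum of every row of [E], so each further multiplication by [E]
    costs at most one factor of it. *)
Lemma norm_mx_exp_le (R : realType) (n : nat) (E : 'M[R]_n.+1) (k : nat) i j :
  `|(E ^+ k) i j| <= (1 + \sum_a \sum_b `|E a b|) ^+ k.
Proof.
set N := 1 + _.
have sum0 a : 0 <= \sum_b `|E a b| by apply: sumr_ge0.
have N1 : 1 <= N by rewrite lerDl sumr_ge0.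
elim: k i j => [|k IH] i j.
  by rewrite !expr0 mxE; case: (i == j); rewrite ?normr1// normr0.
rewrite exprS mxE (le_trans (ler_norm_sum _ _ _))//.
apply: (@le_trans _ _ (\sum_b `|E i b| * N ^+ k)).
  by apply: ler_sum => b _; rewrite normrM ler_wpM2l.
rewrite -mulr_suml exprS ler_wpM2r ?exprn_ge0 ?(le_trans ler01)//.
by rewrite /N [X in _ <= 1 + X](bigD1 i)//= addrCA lerDl addr_ge0// sumr_ge0.
Qed.

Definition even_coef (R : realType) (n : nat) (E : 'M[R]_n.+1) i j (k : nat) : R :=
  (2 * k)`!%:R^-1 * (E ^+ k) i j.

Definition odd_coef (R : realType) (n : nat) (E : 'M[R]_n.+1) i j (k : nat) : R :=
  (2 * k).+1`!%:R^-1 * (E ^+ k) i j.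

Lemma exp_dominated_mx (R : realType) (n : nat) (E : 'M[R]_n.+1) i j
    (a : nat -> nat) : (forall k, (k <= a k)%N) ->
  exp_dominated (fun k => (a k)`!%:R^-1 * (E ^+ k) i j).
Proof.
move=> ka; exists 1, (1 + \sum_a \sum_b `|E a b|) => k.
rewrite mul1r mulrC normrM ler_pM ?norm_mx_exp_le// normfV ger0_norm//.
by rewrite lef_pV2 ?posrE ?ltr0n ?fact_gt0// ler_nat leq_fact.
Qed.

Lemma even_coef_dominated (R : realType) (n : nat) (E : 'M[R]_n.+1) i j :
  exp_dominated (even_coef E i j).
Proof. by apply: exp_dominated_mx => k; rewrite leq_pmull. Qed.

Lemma odd_coef_dominated (R : realType) (n : nat) (E : 'M[R]_n.+1) i j :
  exp_dominated (odd_coef E i j).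
Proof. by apply: exp_dominated_mx => k; rewrite leqW// leq_pmull. Qed.

Lemma even_seriesE (R : realType) (n : nat) (E : 'M[R]_n.+1) t i j :
  (fun N => even_series E t N i j) = pseries (even_coef E i j) (t ^+ 2).
Proof.
apply/funext => N; rewrite /even_series /pseries /series /= summxE.
by apply: eq_bigr => k _; rewrite mxE /even_coef exprM; ring.
Qed.

Lemma odd_seriesE (R : realType) (n : nat) (E : 'M[R]_n.+1) t i j :
  (fun N => odd_series E t N i j) =
  (fun N => t * pseries (odd_coef E i j) (t ^+ 2) N).
Proof.
apply/funext => N; rewrite /odd_series /pseries /series /= summxE mulr_sumr.
by apply: eq_bigr => k _; rewrite mxE /odd_coef exprS exprM; ring.
Qed.

(** The limits are taken entry by entry, as scalar power series in [t ^+ 2], so that termwise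
    differentiation of real power series applies. *)
Definition even_sum (R : realType) (n : nat) (E : 'M[R]_n.+1) (t : R) :=
  \matrix_(i, j) limn (pseries (even_coef E i j) (t ^+ 2)).

Definition odd_sum (R : realType) (n : nat) (E : 'M[R]_n.+1) (t : R) :=
  \matrix_(i, j) (t * limn (pseries (odd_coef E i j) (t ^+ 2))).

Lemma cvg_even_series (R : realType) (n : nat) (E : 'M[R]_n.+1) t :
  even_series E t @ \oo --> even_sum E t.
Proof.
apply/cvg_mxP => i j; rewrite even_seriesE mxE.
exact/is_cvg_exp_dominated/even_coef_dominated.
Qed.

Lemma cvg_odd_series (R : realType) (n : nat) (E : 'M[R]_n.+1) t :
  odd_series E t @ \oo --> odd_sum E t.
Proof.
apply/cvg_mxP => i j; rewrite odd_seriesE mxE.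
apply: cvgM; first exact: cvg_cst.
exact/is_cvg_exp_dominated/odd_coef_dominated.
Qed.

Lemma even_sumN (R : realType) (n : nat) (E : 'M[R]_n.+1) t :
  even_sum E (- t) = even_sum E t.
Proof. by rewrite /even_sum sqrrN. Qed.

Lemma odd_sumN (R : realType) (n : nat) (E : 'M[R]_n.+1) t :
  odd_sum E (- t) = - odd_sum E t.
Proof. by apply/matrixP => i j; rewrite !mxE sqrrN mulNr. Qed.

Lemma odd_sum0 (R : realType) (n : nat) (E : 'M[R]_n.+1) : odd_sum E 0 = 0.
Proof. by apply/matrixP => i j; rewrite !mxE mul0r. Qed.

Lemma even_sum0 (R : realType) (n : nat) (E : 'M[R]_n.+1) : even_sum E 0 = 1%:M.
Proof.
have h : even_series E 0 @ \oo --> (1%:M : 'M[R]_n.+1).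
  (* The empty partial sum is skipped; at [t = 0] all the others equal their term of index 0. *)
  rewrite -cvg_shiftS; apply: cvg_near_cst; near=> N.
  rewrite /even_series /series /= big_nat_recl// big1 ?addr0 => [|k _].
    by rewrite muln0 fact0 !expr0 divr1 scale1r.
  by rewrite exprM expr0n /= exprS !mul0r scale0r.
exact: (cvg_unique _ (@cvg_even_series _ _ E 0) h).
Unshelve. all: by end_near. Qed.

(** The partial sums are polynomials in [E], and commutation with [E] passes to the limit. *)
Lemma odd_sum_comm (R : realType) (n : nat) (E : 'M[R]_n.+1) t :
  E *m odd_sum E t = odd_sum E t *m E.
Proof.
have h1 : (fun N => E *m odd_series E t N) @ \oo --> E *m odd_sum E t.
  by apply: cvg_mulmxl; apply: cvg_odd_series.
have h2 : (fun N => odd_series E t N *m E) @ \oo --> odd_sum E t *m E.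
  by apply: cvg_mulmxr; apply: cvg_odd_series.
suff def_f : (fun N => E *m odd_series E t N) = (fun N => odd_series E t N *m E).
  by rewrite def_f in h1; apply: (cvg_unique _ h1 h2).
apply/funext => N; rewrite /odd_series /series /= mulmx_sumr mulmx_suml.
apply: eq_bigr => k _; rewrite -scalemxAr -scalemxAl; congr (_ *: _).
by rewrite -[LHS]/(E * E ^+ k) -exprS exprSr.
Qed.

(** This is [C' = E S] before the chain rule for [s = t ^ 2] supplies the factor [t]. The partial
    sums agree term by term, as [2 (k + 1) / (2 k + 2)! = 1 / (2 k + 1)!]. *)
Lemma lim_pseries_diffs_even (R : realType) (n : nat) (E : 'M[R]_n.+1) i j s :
  limn (pseries (pseries_diffs (even_coef E i j)) s) * 2 =
  \sum_l E i l * limn (pseries (odd_coef E l j) s).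
Proof.
have h1 : pseries (pseries_diffs (even_coef E i j)) s N * 2 @[N --> \oo] -->
    limn (pseries (pseries_diffs (even_coef E i j)) s) * 2.
  apply: cvgM; last exact: cvg_cst.
  exact/is_cvg_exp_dominated/exp_dominated_diffs/even_coef_dominated.
have h2 : (\sum_l E i l * pseries (odd_coef E l j) s N) @[N --> \oo] -->
    \sum_l E i l * limn (pseries (odd_coef E l j) s).
  apply: cvg_big => [|l _]; first exact: add_continuous.
  apply: cvgM; first exact: cvg_cst.
  exact/is_cvg_exp_dominated/odd_coef_dominated.
suff def_f : (fun N => pseries (pseries_diffs (even_coef E i j)) s N * 2) =
    (fun N => \sum_l E i l * pseries (odd_coef E l j) s N).
  by rewrite def_f in h1; apply: (cvg_unique _ h1 h2).
apply/funext => N; rewrite /pseries /series /= mulr_suml.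
under [RHS]eq_bigr do rewrite mulr_sumr.
rewrite exchange_big; apply: eq_bigr => k _ /=.
rewrite /pseries_diffs /even_coef /odd_coef exprS mxE.
set S := \sum_l _ * _; transitivity ((2 * k).+1`!%:R^-1 * s ^+ k * S); last first.
  by rewrite mulr_sumr; apply: eq_bigr => l _ /=; ring.
have k1 : k.+1%:R != 0 :> R by rewrite pnatr_eq0.
have f0 : (2 * k).+1`!%:R != 0 :> R by rewrite pnatr_eq0 -lt0n fact_gt0.
rewrite mulnS add2n factS natrM (_ : (2 * k).+2%:R = 2 * k.+1%:R :> R).
  by move: k.+1%:R k1 _`!%:R f0 => c c0 f f0; field; rewrite c0 f0.
by rewrite -natrM mulnS.
Qed.

(** This is [S' = C]: with [S = t g(t ^ 2)], the derivative is [g(s) + 2 s g'(s)] at [s = t ^ 2],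
    and [(1 + 2 k) / (2 k + 1)! = 1 / (2 k)!]. *)
Lemma lim_pseries_diffs_odd (R : realType) (n : nat) (E : 'M[R]_n.+1) i j s :
  limn (pseries (odd_coef E i j) s)
    + 2 * s * limn (pseries (pseries_diffs (odd_coef E i j)) s) =
  limn (pseries (even_coef E i j) s).
Proof.
have h1 : pseries (even_coef E i j) s @ \oo -->
    limn (pseries (even_coef E i j) s).
  exact/is_cvg_exp_dominated/even_coef_dominated.
(* The derivative series without the index shift of [pseries_diffs]: it has the same limit, and its
   partial sums match those of the other two series index by index. *)
set u := [series k%:R * odd_coef E i j k * s ^+ k.-1]_k.
have h2 : (pseries (odd_coef E i j) s N + 2 * s * u N) @[N --> \oo] -->
    limn (pseries (odd_coef E i j) s)
    + 2 * s * limn (pseries (pseries_diffs (odd_coef E i j)) s).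
  apply: cvgD; first exact/is_cvg_exp_dominated/odd_coef_dominated.
  apply: cvgM; first exact: cvg_cst.
  apply/pseries_diffs_equiv.
  exact/is_cvg_exp_dominated/exp_dominated_diffs/odd_coef_dominated.
suff def_f : (fun N => pseries (odd_coef E i j) s N + 2 * s * u N) =
    pseries (even_coef E i j) s.
  by rewrite def_f in h2; apply: (cvg_unique _ h2 h1).
apply/funext => N; rewrite /u /pseries /series /= mulr_sumr -big_split.
apply: eq_bigr => k _ /=; rewrite /even_coef /odd_coef.
have -> : 2 * s * (k%:R * ((2 * k).+1`!%:R^-1 * (E ^+ k) i j) * s ^+ k.-1) =
   2 * k%:R * ((2 * k).+1`!%:R^-1 * (E ^+ k) i j * s ^+ k).
  (* At [k = 0], where [s * s ^+ k.-1] is not [s ^+ k], the factor [k] makes both sides vanish. *)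
  case: k => [|k]; first by rewrite !(mul0r, mulr0).
  by rewrite (exprS s) /=; ring.
have -> : 2 * k%:R = (2 * k).+1%:R - 1 :> R.
  by rewrite -(natr1 (2 * k)%N) addrK natrM.
have c0 : (2 * k).+1%:R != 0 :> R by rewrite pnatr_eq0.
have f0 : (2 * k)`!%:R != 0 :> R by rewrite pnatr_eq0 -lt0n fact_gt0.
rewrite factS natrM; move: (2 * k).+1%:R c0 _`!%:R f0 => c c0 f f0.
by field; rewrite c0 f0.
Qed.

Lemma is_derive_lim_pseries_sqr (R : realType) (c : nat -> R) (t : R) :
  exp_dominated c ->
  is_derive t 1 (fun x => limn (pseries c (x ^+ 2)))
    (limn (pseries (pseries_diffs c) (t ^+ 2)) * 2 * t).
Proof.
move=> cP; have h := is_derive_exp_dominated (t ^+ 2) cP.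
have hX : is_derive t 1 (fun x : R => x ^+ 2) (2 * t).
  have -> : (fun x : R => x ^+ 2) = (@id R) ^+ 2 by apply/funext.
  by apply: is_derive_eq; rewrite /= expr1 /GRing.scale /= mulr1.
have := @is_derive1_comp R (fun y => limn (pseries c y)) (fun x => x ^+ 2) t
  _ _ h hX.
by rewrite mulrA.
Qed.

Lemma is_derive_even_sum (R : realType) (n : nat) (E : 'M[R]_n.+1) (t : R) :
  is_derive t 1 (even_sum E) (E *m odd_sum E t).
Proof.
apply/is_derive_mxP => i j.
under eq_fun do rewrite mxE.
have h := is_derive_lim_pseries_sqr t (even_coef_dominated E i j).
apply: (is_derive_eq h); rewrite lim_pseries_diffs_even mxE mulr_suml.
by apply: eq_bigr => l _; rewrite mxE mulrA mulrAC.
Qed.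

Lemma is_derive_odd_sum (R : realType) (n : nat) (E : 'M[R]_n.+1) (t : R) :
  is_derive t 1 (odd_sum E) (even_sum E t).
Proof.
apply/is_derive_mxP => i j.
under eq_fun do rewrite mxE.
have h := is_derive_lim_pseries_sqr t (odd_coef_dominated E i j).
apply: (is_derive_eq (is_deriveM (is_derive_id t 1) h)).
rewrite mxE -lim_pseries_diffs_odd /GRing.scale /= mulr1 addrC.
by congr (_ + _); ring.
Qed.

(** * Complex hyperbolic functions *)

Lemma cvg_map_mx_isometry (R K : numFieldType) (f : {rmorphism R -> K})
    (m n : nat) (u : nat -> 'M[R]_(m, n)) (M : 'M[R]_(m, n)) :
  (forall x, `|f x| = f `|x|) ->
  (forall e : K, 0 < e -> exists2 d, 0 < d & forall x, x < d -> f x < e) ->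
  u @ \oo --> M -> (fun N => map_mx f (u N)) @ \oo --> map_mx f M.
Proof.
move=> f_norm f_small /cvg_mxP uM; apply/cvg_mxP => i j; rewrite mxE.
under eq_cvg do rewrite mxE.
apply/cvgrPdist_lt => e /f_small[d d0 de].
have /cvgrPdist_lt/(_ d d0) := uM i j; apply: filterS => N.
by rewrite -rmorphB f_norm; apply: de.
Qed.

Lemma cvg_complex_mx (R : realType) (m n : nat) (u : nat -> 'M[R]_(m, n))
    (M : 'M[R]_(m, n)) :
  u @ \oo --> M ->
  (fun N => complex_mx (u N) : 'M[(R[i] : numFieldType)]_(m, n)) @ \oo -->
  (complex_mx M : 'M[(R[i] : numFieldType)]_(m, n)).
Proof.
apply: (@cvg_map_mx_isometry R R[i] (real_complex R)) => [x|e].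
  by rewrite normc_def /= expr0n addr0 sqrtr_sqr.
(* A positive element of [R[i]] has zero imaginary part, so its real part serves as the
   threshold. *)
rewrite ltcE /= => /andP[e1 e0]; exists (complex.Re e) => // x xe.
by rewrite ltcE /= e1.
Qed.

Lemma mxcosh_sqrt (R : realType) (n : nat) (E : 'M[R]_n.+1) (W : 'M[R[i]]_n.+1) t :
  W ^+ 2 = complex_mx E ->
  mxcosh (real_complex R t *: W) = complex_mx (even_sum E t).
Proof.
move=> W2; apply: cvg_lim; first exact: norm_hausdorff.
have h := cvg_complex_mx (@cvg_even_series R n E t).
rewrite (_ : [series _]_k = (fun N => complex_mx (even_series E t N))) //.
apply/funext => N; apply/esym.
rewrite /even_series /series /= /complex_mx raddf_sum; apply: eq_bigr => k _.
rewrite /= map_mxZ rmorphXn /= -/(complex_mx E) -W2 exprZn scalerA -exprM.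
by rewrite fmorph_div rmorphXn rmorph_nat mulrC.
Qed.

(** Every odd power of [W] is [W] times a power of [E]. The factor [W] left in front is what the
    inverse of the square root cancels in the closed form of the solution. *)
Lemma mxsinh_sqrt (R : realType) (n : nat) (E : 'M[R]_n.+1) (W : 'M[R[i]]_n.+1) t :
  W ^+ 2 = complex_mx E ->
  mxsinh (real_complex R t *: W) = W *m complex_mx (odd_sum E t).
Proof.
move=> W2; apply: cvg_lim; first exact: norm_hausdorff.
have h := cvg_complex_mx (@cvg_odd_series R n E t).
rewrite (_ : [series _]_k = (fun N => W *m complex_mx (odd_series E t N))).
  exact: cvg_mulmxl h.
apply/funext => N; apply/esym.
rewrite /odd_series /series /= /complex_mx raddf_sum mulmx_sumr.
apply: eq_bigr => k _.
rewrite /= map_mxZ rmorphXn /= -/(complex_mx E) -W2 exprZn scalerA -exprM.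
rewrite -scalemxAr fmorph_div rmorphXn rmorph_nat mulrC.
by congr (_ *: _); rewrite [RHS]exprS.
Qed.

(** * The differential equation with reflection *)

(* For fixed [T], the combination [C(T - s) e(s) - S(T - s) P o(s)] does not
   depend on [s]; compare its values at [s = T] and [s = 0]. *)
Lemma coupled_system_unique (R : realType) (n m : nat) (P K : 'M[R]_n.+1)
    (e o : R -> 'M[R]_(n.+1, m)) :
  (forall t : R, is_derive t (1 : R) e (- (P *m o t))) ->
  (forall t : R, is_derive t (1 : R) o (- (K *m e t))) -> o 0 = 0 ->
  forall t, e t = even_sum (P *m K) t *m e 0 /\
            o t = - (K *m odd_sum (P *m K) t *m e 0).
Proof.
move=> de dO o0; set E := P *m K.
have eE T : e T = even_sum E T *m e 0.
  pose w s := even_sum E (T - s) *m e s - odd_sum E (T - s) *m (P *m o s).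
  have refl_T (s : R) : is_derive s (1 : R) (fun s : R => T - s) (-1).
    apply: (is_derive_eq (is_deriveB (is_derive_cst T s 1) (is_derive_id s 1))).
    by rewrite sub0r.
  have dw s : is_derive s (1 : R) w 0.
    have hC := is_derive_mx_comp (g := fun s => T - s)
      (is_derive_even_sum E (T - s)) (refl_T s).
    have hS := is_derive_mx_comp (g := fun s => T - s)
      (is_derive_odd_sum E (T - s)) (refl_T s).
    apply: (is_derive_eq (is_deriveB (is_derive_mulmx hC (de s))
      (is_derive_mulmx hS (is_derive_mulmxl P (dO s))))).
    (* The terms in [o] cancel directly, those in [e] because [E] commutes with [odd_sum E]. *)
    rewrite !scaleN1r !mulmxN !mulNmx odd_sum_comm /E !mulmxA.
    by rewrite [X in X - _]addrC subrr.
  have := is_derive_mx_0_is_cst T 0 dw.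
  by rewrite /w subrr subr0 odd_sum0 even_sum0 mul1mx mul0mx subr0 o0 !mulmx0 subr0.
move=> t; split; first exact: eE.
(* With [e] known, [o' = - K e] is integrated directly, [even_sum E] being the derivative of
   [odd_sum E]. *)
have dv s : is_derive s (1 : R) (fun s => o s + K *m odd_sum E s *m e 0) 0.
  have hS := is_derive_mulmx (is_derive_mulmxl K (is_derive_odd_sum E s))
    (is_derive_cst (e 0) s 1).
  apply: (is_derive_eq (is_deriveD (dO s) hS)).
  by rewrite mulmx0 addr0 {1}eE mulmxA addNr.
have := is_derive_mx_0_is_cst t 0 dv.
by rewrite odd_sum0 mulmx0 mul0mx addr0 o0 => /eqP; rewrite addr_eq0 => /eqP.
Qed.

Definition fundamental_sum (R : realType) (n : nat) (P K : 'M[R]_n.+1) (t : R) :=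
  even_sum (P *m K) t - K *m odd_sum (P *m K) t.

Lemma is_derive_fundamental_sum (R : realType) (n : nat) (P K : 'M[R]_n.+1) (t : R) :
  is_derive t 1 (fundamental_sum P K)
    (P *m K *m odd_sum (P *m K) t - K *m even_sum (P *m K) t).
Proof.
exact: is_deriveB (is_derive_even_sum _ t)
  (is_derive_mulmxl K (is_derive_odd_sum _ t)).
Qed.

(** By parity the left-hand side becomes [(F - G) E S - (A - B) K S + (A + B) C - (F + G) K C],
    where the two hypotheses cancel the terms in pairs. *)
Lemma fundamental_sum_eq (R : realType) (n : nat) (A B F G P K : 'M[R]_n.+1) :
  (F - G) *m P = A - B -> (F + G) *m K = A + B ->
  reflection_eq F G A B (fundamental_sum P K).
Proof.
move=> FP FK t; rewrite !derive1E.
have [_ ->] := is_derive_fundamental_sum P K t.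
have [_ ->] := is_derive_fundamental_sum P K (- t).
rewrite /fundamental_sum even_sumN odd_sumN !mulmxN opprK.
set E := P *m K.
have FE : (F - G) *m E = (A - B) *m K by rewrite /E mulmxA FP.
set C := even_sum E t; set S := odd_sum E t.
rewrite !mulmxBr !mulmxDr !mulmxN.
have FKC : (A + B) *m C = (F + G) *m (K *m C) by rewrite mulmxA FK.
have FES : (F - G) *m (E *m S) = (A - B) *m (K *m S).
  by rewrite (mulmxA _ E S) FE (mulmxA _ K S).
move: FKC FES; rewrite !mulmxDl !mulNmx.
move: (A *m C) (B *m C) (F *m (K *m C)) (G *m (K *m C)) (F *m (E *m S)).
move: (G *m (E *m S)) (A *m (K *m S)) (B *m (K *m S)).
move=> a b c d e f g h /matrixP h1 /matrixP h2; apply/matrixP => i j.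
by have := h1 i j; have := h2 i j; rewrite !mxE; lra.
Qed.

Lemma fundamental_sum0 (R : realType) (n : nat) (P K : 'M[R]_n.+1) :
  fundamental_sum P K 0 = 1%:M.
Proof. by rewrite /fundamental_sum even_sum0 odd_sum0 mulmx0 subr0. Qed.

Lemma solution_fundamental_sum (R : realType) (n : nat)
    (A B F G P K : 'M[R]_n.+1) (u : R -> 'cV[R]_n.+1) (t : R) :
  F - G \in unitmx -> F + G \in unitmx ->
  (F - G) *m P = A - B -> (F + G) *m K = A + B ->
  solutions F G A B u -> u t = fundamental_sum P K t *m u 0.
Proof.
move=> FBG_unit FDG_unit FP FK [du equ]; pose v := derive1 u.
have dv s : is_derive s (1 : R) u (v s) by rewrite /v derive1E; exact: derivableP.
have dvN s : is_derive s (1 : R) (fun s => u (- s)) (- v (- s)).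
  have hN : is_derive s (1 : R) (fun s : R => - s) (-1).
    exact: is_deriveN (is_derive_id s 1).
  have := is_derive_mx_comp (g := fun s => - s) (dv (- s)) hN.
  by rewrite scaleN1r.
pose e s := u s + u (- s); pose o s := u s - u (- s).
(* Subtracting the equations at [s] and [- s] isolates [F - G], adding them isolates [F + G]; both
   factors are then cancelled. *)
have h s : v s - v (- s) = - (P *m o s) /\ v s + v (- s) = - (K *m e s).
  have := equ s; have := equ (- s); rewrite opprK -!/(v _) /o /e.
  move: (u s) (u (- s)) (v s) (v (- s)) => x y z w eq1 eq2; split.
    apply: (can_inj (mulKmx FBG_unit)); rewrite mulmxN mulmxA FP.
    apply/matrixP => i j; move: eq1 eq2 => /matrixP/(_ i j) + /matrixP/(_ i j).
    by rewrite !mulmxBr !mulmxDl !mulNmx !mxE; lra.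
  apply: (can_inj (mulKmx FDG_unit)); rewrite mulmxN mulmxA FK.
  apply/matrixP => i j; move: eq1 eq2 => /matrixP/(_ i j) + /matrixP/(_ i j).
  by rewrite !mulmxDr !mulmxDl !mxE; lra.
have de s : is_derive s (1 : R) e (- (P *m o s)).
  by rewrite -(h s).1; apply: is_deriveD (dv s) (dvN s).
have dO s : is_derive s (1 : R) o (- (K *m e s)).
  by rewrite -(h s).2 -[v (- s)]opprK; apply: is_deriveB (dv s) (dvN s).
have o0 : o 0 = 0 by rewrite /o oppr0 subrr.
have [et ot] := coupled_system_unique de dO o0 t.
(* The factor 2 is offset by [e 0], which is twice [u 0]. *)
have /(congr1 (fun w => 2^-1 *: w)) : e t + o t = 2 *: u t.
  by rewrite /e /o addrACA subrr addr0 scaler_nat mulr2n.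
rewrite scalerA mulVf ?pnatr_eq0// scale1r => <-.
rewrite et ot /e oppr0 -mulr2n -[u 0 *+ 2]scaler_nat -mulNmx -mulmxDl.
rewrite -scalemxAr scalerA.
by rewrite mulVf ?pnatr_eq0// scale1r.
Qed.

(** Since [X 0] is the identity, evaluation at 0 reads off the coefficients of a combination of
    columns. This gives independence, and spanning with the entries of [u 0] as coefficients. *)
Lemma fundamental_matrix_sum (R : realType) (n : nat)
    (A B F G P K : 'M[R]_n.+1) :
  F - G \in unitmx -> F + G \in unitmx ->
  (F - G) *m P = A - B -> (F + G) *m K = A + B ->
  fundamental_matrix F G A B (fundamental_sum P K).
Proof.
move=> FBG_unit FDG_unit FP FK; set X := fundamental_sum P K.
have X0 : X 0 = 1%:M := fundamental_sum0 P K.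
have Xeq : reflection_eq F G A B X by exact: fundamental_sum_eq.
have dX t : derivable X t 1 by have [] := is_derive_fundamental_sum P K t.
have colX j t : is_derive t (1 : R) (fun t => col j (X t)) (col j (derive1 X t)).
  have dXt : is_derive t (1 : R) X (derive1 X t).
    by rewrite derive1E; exact: derivableP.
  under eq_fun do rewrite colE.
  have := is_derive_mulmx dXt (is_derive_cst (delta_mx j (0 : 'I_1)) t 1).
  by rewrite mulmx0 addr0 colE.
split=> //.
- move=> t; apply/differentiable_continuous/derivable1_diffP; exact: dX.
- by rewrite X0 unitmx1.
split=> [j|c c0 j|u uP].
- split=> [t|t]; first by have [] := colX j t.
  rewrite !derive1E; have [_ ->] := colX j t; have [_ ->] := colX j (- t).
  have := Xeq t; move: (derive1 X t) (derive1 X (- t)) (X t) (X (- t)).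
  by move=> a b c d abcd; rewrite !colE !mulmxA -!mulmxDl abcd mul0mx.
- have /(congr1 (fun f : R -> 'cV[R]_n.+1 => f 0 j 0)) := c0.
  have entry k : (c k *: (fun t => col k (X t))) 0 j 0 = c k * (j == k)%:R.
    by rewrite -[LHS]/((c k *: col k (X 0)) j 0) X0 !mxE.
  rewrite fct_sumE summxE (bigD1 j)//= big1 ?addr0 => [|k kj].
    by rewrite entry eqxx mulr1 => ->; apply: mxE.
  by rewrite entry eq_sym (negPf kj) mulr0.
- exists (fun j => u 0 j 0); apply/funext => t; rewrite fct_sumE.
  rewrite (solution_fundamental_sum t FBG_unit FDG_unit FP FK uP).
  apply/matrixP => i k; rewrite ord1 mxE summxE; apply: eq_bigr => j _.
  by rewrite !mxE mulrC.
Qed.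

Theorem theorem4p5 (R : realType) (n : nat) (A B F G : 'M[R]_n.+1)
    (FBG_unit : F - G \in unitmx) (FDG_unit : F + G \in unitmx) :
  let E := invmx (F - G) *m (A - B) *m invmx (F + G) *m (A + B) in
  let X := fun t : R => limn (even_series E t)
             - invmx (F + G) *m (A + B) *m limn (odd_series E t) in
  [/\ forall t : R, cvgn (even_series E t) /\ cvgn (odd_series E t),
      fundamental_matrix F G A B X
    & A - B \in unitmx -> A + B \in unitmx ->
      [/\ E \in unitmx,
          exists Omega, is_principal_sqrtmx (complex_mx E) Omega
        & forall Omega, is_principal_sqrtmx (complex_mx E) Omega ->
          Omega \in unitmx /\
          forall t : R,
            complex_mx (X t) =
            mxcosh (real_complex R t *: Omega)
            - complex_mx (invmx (F + G) *m (A + B)) *m invmx Omega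
                *m mxsinh (real_complex R t *: Omega)]].
Proof.
move=> E X; set K := invmx (F + G) *m (A + B); pose P := invmx (F - G) *m (A - B).
have def_E : E = P *m K by rewrite /E /P /K !mulmxA.
have lim_even t : limn (even_series E t) = even_sum E t.
  by apply: cvg_lim; [exact: norm_hausdorff|exact: cvg_even_series].
have lim_odd t : limn (odd_series E t) = odd_sum E t.
  by apply: cvg_lim; [exact: norm_hausdorff|exact: cvg_odd_series].
have def_X t : X t = even_sum E t - K *m odd_sum E t by rewrite /X lim_even lim_odd.
split=> [t||ABu ADu].
- split; apply/cvg_ex; first by exists (even_sum E t); apply: cvg_even_series.
  by exists (odd_sum E t); apply: cvg_odd_series.
- have -> : X = fundamental_sum P K.
    by apply/funext => t; rewrite def_X /fundamental_sum def_E.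
  by apply: fundamental_matrix_sum; rewrite // /P /K mulmxA mulmxV// mul1mx.
have Eu : E \in unitmx.
  by rewrite /E !unitmx_mul !unitmx_inv FBG_unit FDG_unit ABu ADu.
have Ecu : complex_mx E \in unitmx by rewrite map_unitmx.
split=> // [|W /(principal_sqrtmx_sqr Ecu) W2]; first exact: principal_sqrtmx_exists.
(* A factor of the invertible product [W * W] is invertible. *)
have Wu : W \in unitmx by move: Ecu; rewrite -W2 expr2 unitmx_mul => /andP[].
split=> // t; rewrite (mxcosh_sqrt t W2) (mxsinh_sqrt t W2) def_X.
by rewrite mulmxA mulmxKV// /complex_mx map_mxB map_mxM.
Qed.
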